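(* Let $A\in\mathbb{C}^{m\times n}$ and $B\in\mathbb{C}^{n\times \ell}$, and let $M,N,L$ be weights of order $m,n,\ell$ respectively. If $A^{[\dagger]}$ and $B^{[\dagger]}$ exist, then the following are equivalent: (i) $A^{[*]}ABB^{[*]}$ is range Hermitian. (ii) $R(A^{[*]}AB)\subseteq R(B)$ and $R(BB^{[*]}A^{[*]})\subseteq R(A^{[*]})$. (iii) $BB^{[\dagger]}A^{[*]}A$ and $A^{[\dagger]}ABB^{[*]}$ are range Hermitian. (iv) $BB^{[\dagger]}A^{[*]}AB=A^{[*]}AB$ and $A^{[\dagger]}ABB^{[*]}A^{[*]}=BB^{[*]}A^{[*]}$.
   Context: All matrices are complex, $X^*$ denotes the complex conjugate transpose and $R(X)$ the range (column space) of $X$. A weight of order $n$ is an invertible Hermitian $n\times n$ matrix (not necessarily positive definite). The spaces $\mathbb{C}^m,\mathbb{C}^n,\mathbb{C}^\ell$ carry fixed weights $M,N,L$. The adjoint of a matrix $X\in\mathbb{C}^{p\times q}$ between spaces with weights $W_p$ (on $\mathbb{C}^p$) and $W_q$ (on $\mathbb{C}^q$) is $X^{[*]}=W_q^{-1}X^*W_p$; thus $A^{[*]}=N^{-1}A^*M$, $B^{[*]}=L^{-1}B^*N$, and a square matrix $X$ acting on $\mathbb{C}^n$ has $X^{[*]}=N^{-1}X^*N$. A square matrix $X\in\mathbb{C}^{n\times n}$ is range Hermitian (with respect to $N$) if $R(X)=R(X^{[*]})$. The Moore-Penrose inverse $X^{[\dagger]}$ of $X\in\mathbb{C}^{p\times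 q}$ is the unique $Y\in\mathbb{C}^{q\times p}$, if it exists, satisfying $XYX=X$, $YXY=Y$, $(XY)^{[*]}=XY$ and $(YX)^{[*]}=YX$. It need not exist. *)

(* Defs.v *)
From mathcomp Require Import all_boot all_order all_algebra.
From mathcomp Require Import boolp classical_sets reals.
From mathcomp Require Import complex.

Set Implicit Arguments.
Unset Strict Implicit.
Unset Printing Implicit Defensive.

Import GRing.Theory Num.Theory.
Local Open Scope classical_set_scope.
Local Open Scope ring_scope.
Local Open Scope sesquilinear_scope.

Definition weight (C : numClosedFieldType) (n : nat) (W : 'M[C]_n) : Prop :=
  W \in unitmx /\ W \is hermsymmx.

(* X is p x q, i.e. it maps C^q (weight Wq) to C^p (weight Wp). *)
Definition wadj (C : numClosedFieldType) (p q : nat) (Wp : 'M[C]_p)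
    (Wq : 'M[C]_q) (X : 'M[C]_(p, q)) : 'M[C]_(q, p) :=
  invmx Wq *m X^t* *m Wp.

(* The column space, as a set of column vectors; %MS is about row spaces. *)
Definition mxrange (C : numClosedFieldType) (p q : nat) (X : 'M[C]_(p, q)) :
    set 'cV[C]_p :=
  range (fun v : 'cV[C]_q => X *m v).

Definition range_hermitian (C : numClosedFieldType) (n : nat) (N X : 'M[C]_n) :
    Prop :=
  mxrange X = mxrange (wadj N N X).

(* Y is the Moore-Penrose inverse of X; it need not exist, but it is unique
   (wMP_inverse_uniq). *)
Definition wMP_inverse (C : numClosedFieldType) (p q : nat) (Wp : 'M[C]_p)
    (Wq : 'M[C]_q) (X : 'M[C]_(p, q)) (Y : 'M[C]_(q, p)) : Prop :=
  [/\ X *m Y *m X = X,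
      Y *m X *m Y = Y,
      wadj Wp Wp (X *m Y) = X *m Y
    & wadj Wq Wq (Y *m X) = Y *m X].

Lemma wadjM (C : numClosedFieldType) (p q r : nat) (Wp : 'M[C]_p)
    (Wq : 'M[C]_q) (Wr : 'M[C]_r) (X : 'M[C]_(p, q)) (Y : 'M[C]_(q, r)) :
  Wq \in unitmx ->
  wadj Wp Wr (X *m Y) = wadj Wq Wr Y *m wadj Wp Wq X.
Proof.
by move=> uW; rewrite /wadj trmx_mul map_mxM /= !mulmxA mulmxK.
Qed.

Lemma wMP_inverse_uniq (C : numClosedFieldType) (p q : nat) (Wp : 'M[C]_p)
    (Wq : 'M[C]_q) (X : 'M[C]_(p, q)) (Y Z : 'M[C]_(q, p)) :
  weight Wp -> weight Wq ->
  wMP_inverse Wp Wq X Y -> wMP_inverse Wp Wq X Z -> Y = Z.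
Proof.
move=> [uWp _] [uWq _] [xyx yxy xy yx] [xzx zxz xz zx].
have xyz : X *m Y = X *m Z.
  have /(congr1 (wadj Wp Wp)) : X *m Y *m (X *m Z) = X *m Z by rewrite mulmxA xyx.
  by rewrite (wadjM _ _ _ _ uWp) xy xz mulmxA xzx.
have yzx : Y *m X = Z *m X.
  have /(congr1 (wadj Wq Wq)) : Z *m X *m (Y *m X) = Z *m X.
    by rewrite -mulmxA (mulmxA X) xyx.
  by rewrite (wadjM _ _ _ _ uWq) yx zx -mulmxA (mulmxA X) xzx.
by rewrite -yxy yzx -mulmxA xyz mulmxA zxz.
Qed.

(* Main.v *)
Require Import Defs.
From mathcomp Require Import all_boot all_order all_algebra.
From mathcomp Require Import boolp classical_sets reals.
From mathcomp Require Import complex.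

Set Implicit Arguments.
Unset Strict Implicit.
Unset Printing Implicit Defensive.

Import GRing.Theory Num.Theory.
Local Open Scope classical_set_scope.
Local Open Scope ring_scope.

(** Write [#] for the weighted adjoint and put S = A#A, Q = A^+ A, T = BB#,
    P = BB^+. All four are self-adjoint, Q and P are the idempotents with the
    ranges of A# and B, and S and T are invertible up to these idempotents:
    S S' = Q with S' = A^+ (A^+)#, and T T' = P likewise
    ([projected_gram_wMP]). As R(S) = R(A#) and R(T) = R(B), each of the four
    statements is about S, T, Q, P only, and each is equivalent to

      P S = S P   and   Q T = T Q.

    - The range inclusions of (ii) and the equations of (iv) both say that P
      fixes S B and Q fixes T A#, hence that P S P = S P and Q T Q = T Q. The
      left-hand sides are self-adjoint, so S P and T Q are self-adjoint too,
      which is the commutation ([selfadjoint_compress_comm]).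
    - In (iii), (PS)# = SP. Commutation makes PS self-adjoint; conversely
      R(PS) = R(SP) puts R(SP) inside R(P), so that P S P = S P.
    - In (i), (ST)# = TS. If R(ST) = R(TS), this common range lies in both
      R(B) and R(A#), which gives (ii). For the converse, P commutes with S and
      therefore with the idempotent Q onto R(S)
      ([projected_gram_proj_comm]), and then
      R(ST) = R(SP) = R(PS) = R(PQ) = R(QP) = R(QT) = R(TQ) = R(TS)
      ([projected_gram_range_sub] composes these steps).

    The roles of A# and B are symmetric: S = A# (A#)# and Q = A# (A#)^+ arise
    from A# as T and P arise from B. So each fact is proved for B and then also
    used for A#. *)

(** * Column spaces *)

Lemma mxrange_mulmx_sub (C : numClosedFieldType) (p q r : nat)
    (X : 'M[C]_(p, q)) (Y : 'M[C]_(q, r)) :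
  mxrange (X *m Y) `<=` mxrange X.
Proof. by move=> _ [v _ <-]; exists (Y *m v) => //; rewrite mulmxA. Qed.

Lemma mxrange_sub_fix (C : numClosedFieldType) (p q r : nat)
    (P : 'M[C]_p) (X : 'M[C]_(p, q)) (Y : 'M[C]_(p, r)) :
  P *m Y = Y -> mxrange X `<=` mxrange Y -> P *m X = X.
Proof.
move=> PY sXY; apply/matrixP => i j.
suff /colP/(_ i) : col j (P *m X) = col j X by rewrite !mxE.
rewrite !colE -mulmxA.
have [|v _ <-] := sXY (X *m delta_mx j 0); first by exists (delta_mx j 0).
by rewrite mulmxA PY.
Qed.

(** * The weighted adjoint *)

(** This is where hermitianness of the weights enters: it lets the conjugate
    transpose of each weight cancel against the weight itself. *)
Lemma wadjK (C : numClosedFieldType) (p q : nat) (Wp : 'M[C]_p)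
    (Wq : 'M[C]_q) (X : 'M[C]_(p, q)) :
  weight Wp -> weight Wq -> wadj Wq Wp (wadj Wp Wq X) = X.
Proof.
move=> [uWp /is_hermitianmxP hWp] [uWq /is_hermitianmxP hWq].
rewrite !expr0 !scale1r in hWp hWq.
rewrite /wadj !trmx_mul !map_mxM /= trmx_inv map_invmx -hWp -hWq.
rewrite map_trmx trmxK map_mxCK !mulmxA mulVmx // mul1mx -mulmxA mulVmx //.
by rewrite mulmx1.
Qed.

(** This makes A# and B interchangeable: what is proved for a B with an inverse
    B^+ applies to A# with the inverse (A^+)#. *)
Lemma wMP_inverse_wadj (C : numClosedFieldType) (p q : nat) (Wp : 'M[C]_p)
    (Wq : 'M[C]_q) (X : 'M[C]_(p, q)) (Y : 'M[C]_(q, p)) :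
  weight Wp -> weight Wq -> wMP_inverse Wp Wq X Y ->
  wMP_inverse Wq Wp (wadj Wp Wq X) (wadj Wq Wp Y).
Proof.
move=> [uWp _] [uWq _] [xyx yxy xy yx]; split.
- by rewrite -mulmxA -(wadjM _ _ _ _ uWq) -(wadjM _ _ _ _ uWp) xyx.
- by rewrite -mulmxA -(wadjM _ _ _ _ uWp) -(wadjM _ _ _ _ uWq) yxy.
- by rewrite -(wadjM _ _ _ _ uWp) !yx.
- by rewrite -(wadjM _ _ _ _ uWq) !xy.
Qed.

(** P S P is self-adjoint, so S P is self-adjoint as soon as it equals P S P,
    and the adjoint of S P is P S. *)
Lemma selfadjoint_compress_comm (C : numClosedFieldType) (n : nat)
    (N P S : 'M[C]_n) :
  N \in unitmx -> wadj N N P = P -> wadj N N S = S ->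
  P *m S *m P = S *m P -> P *m S = S *m P.
Proof.
move=> uN Psa Ssa PSP; have := congr1 (wadj N N) PSP.
by rewrite !(wadjM _ _ _ _ uN) Psa Ssa mulmxA PSP => ->.
Qed.

Lemma range_hermitianM (C : numClosedFieldType) (n : nat) (N X Y : 'M[C]_n) :
  N \in unitmx -> wadj N N X = X -> wadj N N Y = Y ->
  range_hermitian N (X *m Y) <-> mxrange (X *m Y) = mxrange (Y *m X).
Proof.
by move=> uN Xsa Ysa; rewrite /range_hermitian (wadjM _ _ _ _ uN) Xsa Ysa.
Qed.

(** * Self-adjoint matrices invertible up to a projection *)

(** The common shape of A#A and BB#: the last two equations make Q an idempotent
    with the range of S. With an indefinite weight such a self-adjoint Q need
    not exist for every self-adjoint S. *)
Definition projected_gram (C : numClosedFieldType) (n : nat)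
    (N S Q S' : 'M[C]_n) : Prop :=
  [/\ wadj N N S = S, wadj N N Q = Q, S *m S' = Q & Q *m S = S].

Lemma projected_gram_wMP (C : numClosedFieldType) (p q : nat) (Wp : 'M[C]_p)
    (Wq : 'M[C]_q) (X : 'M[C]_(p, q)) (Y : 'M[C]_(q, p)) :
  weight Wp -> weight Wq -> wMP_inverse Wp Wq X Y ->
  projected_gram Wp (X *m wadj Wp Wq X) (X *m Y) (wadj Wq Wp Y *m Y).
Proof.
move=> hp hq [xyx yxy xy yx]; have [uWp _] := hp; have [uWq _] := hq.
split=> //; first by rewrite (wadjM _ _ _ _ uWq) wadjK.
- rewrite mulmxA -(mulmxA X) -(wadjM _ _ _ _ uWp) yx.
  by rewrite mulmxA xyx.
- by rewrite !mulmxA xyx.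
Qed.

(** P commutes with S, hence P Q = P S S' = S P S' has its range inside that of
    S, which Q fixes. *)
Lemma projected_gram_proj_comm (C : numClosedFieldType) (n : nat)
    (N S Q S' P : 'M[C]_n) :
  N \in unitmx -> projected_gram N S Q S' -> wadj N N P = P ->
  P *m S = S *m P -> Q *m P = P *m Q.
Proof.
move=> uN [_ Qsa SS' QS] Psa PS.
apply: (selfadjoint_compress_comm uN Qsa Psa).
by rewrite -SS' !mulmxA -[_ *m P *m S]mulmxA PS mulmxA SS' QS.
Qed.

(** The chain R(ST) = R(SP) = R(PS) = R(PQ) = R(QP) = R(QT) = R(TQ) = R(TS),
    composed into one explicit factor:
    ST = S P T = P Q S T = Q P S T = Q T T'S T = T Q T'S T = T S (S'T'S T). *)
Lemma projected_gram_range_sub (C : numClosedFieldType) (n : nat)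
    (N S Q S' T P T' : 'M[C]_n) :
  N \in unitmx -> projected_gram N S Q S' -> projected_gram N T P T' ->
  P *m S = S *m P -> Q *m T = T *m Q ->
  mxrange (S *m T) `<=` mxrange (T *m S).
Proof.
move=> uN gS gT PS QT; have [_ Psa TT' PT] := gT.
have QP := projected_gram_proj_comm uN gS Psa PS.
have [_ _ SS' QS] := gS.
have -> : S *m T = T *m S *m (S' *m T' *m S *m T).
  rewrite -{1}PT mulmxA -PS -{1}QS !mulmxA -QP -TT' !mulmxA QT.
  by rewrite -SS' !mulmxA.
exact: mxrange_mulmx_sub.
Qed.

(** * The two halves of each condition *)

(** Since P = B B^+ and P B = B, P fixes S B exactly when it fixes
    S P, and [selfadjoint_compress_comm] turns the latter into commutation. *)
Lemma fix_mulmx_proj_comm (C : numClosedFieldType) (n l : nat)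
    (N : 'M[C]_n) (L : 'M[C]_l) (S : 'M[C]_n) (B : 'M[C]_(n, l))
    (Bd : 'M[C]_(l, n)) :
  N \in unitmx -> wMP_inverse N L B Bd -> wadj N N S = S ->
  B *m Bd *m S *m B = S *m B <-> B *m Bd *m S = S *m (B *m Bd).
Proof.
move=> uN [bdb _ Psa _] Ssa; split=> [PSB | ->].
  apply: (selfadjoint_compress_comm uN Psa Ssa).
  by rewrite !mulmxA PSB.
by rewrite -mulmxA bdb.
Qed.

Lemma range_sub_fix_mulmx (C : numClosedFieldType) (n l : nat)
    (N : 'M[C]_n) (L : 'M[C]_l) (S : 'M[C]_n) (B : 'M[C]_(n, l))
    (Bd : 'M[C]_(l, n)) :
  wMP_inverse N L B Bd ->
  mxrange (S *m B) `<=` mxrange B <-> B *m Bd *m S *m B = S *m B.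
Proof.
move=> [bdb _ _ _]; split=> [/(mxrange_sub_fix bdb) | <-].
  by rewrite !mulmxA.
by rewrite -!mulmxA; apply: mxrange_mulmx_sub.
Qed.

(** R(PS) = R(SP) puts R(SP) inside R(P), where P acts as the identity. *)
Lemma range_hermitian_proj_comm (C : numClosedFieldType) (n : nat)
    (N P S : 'M[C]_n) :
  N \in unitmx -> wadj N N P = P -> wadj N N S = S -> P *m P = P ->
  range_hermitian N (P *m S) <-> P *m S = S *m P.
Proof.
move=> uN Psa Ssa PP; rewrite (range_hermitianM uN Psa Ssa).
split=> [eqR | -> //]; apply: (selfadjoint_compress_comm uN Psa Ssa).
rewrite -mulmxA; apply: (mxrange_sub_fix PP).
by rewrite -eqR; apply: mxrange_mulmx_sub.
Qed.

(** B = BB# (B^+)#, so R(S B) lies in R(S BB#); equality of the two ranges of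
    the products S BB# and BB# S then confines it to R(B). *)
Lemma eq_range_sub (C : numClosedFieldType) (n l : nat)
    (N : 'M[C]_n) (L : 'M[C]_l) (S : 'M[C]_n) (B : 'M[C]_(n, l))
    (Bd : 'M[C]_(l, n)) :
  N \in unitmx -> wMP_inverse N L B Bd ->
  let T := B *m wadj N L B in
  mxrange (S *m T) = mxrange (T *m S) -> mxrange (S *m B) `<=` mxrange B.
Proof.
move=> uN [bdb _ _ qsa] T eqR.
have TBd : T *m wadj L N Bd = B.
  by rewrite /T -mulmxA -(wadjM _ _ _ _ uN) qsa mulmxA.
rewrite -{1}TBd mulmxA.
apply: (subset_trans (@mxrange_mulmx_sub _ _ _ _ _ _)).
by rewrite eqR /T -mulmxA; apply: mxrange_mulmx_sub.
Qed.

(** * The equivalence *)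

Lemma range_hermitian_gram_product_tfae (C : numClosedFieldType) (m n l : nat)
    (M : 'M[C]_m) (N : 'M[C]_n) (L : 'M[C]_l)
    (A : 'M[C]_(m, n)) (B : 'M[C]_(n, l))
    (Ad : 'M[C]_(n, m)) (Bd : 'M[C]_(l, n))
    (hM : weight M) (hN : weight N) (hL : weight L)
    (hAd : wMP_inverse M N A Ad) (hBd : wMP_inverse N L B Bd) :
  let As := wadj M N A in
  let Bs := wadj N L B in
  [<-> range_hermitian N (As *m A *m B *m Bs);
       mxrange (As *m A *m B) `<=` mxrange B
         /\ mxrange (B *m Bs *m As) `<=` mxrange As;
       range_hermitian N (B *m Bd *m As *m A)
         /\ range_hermitian N (Ad *m A *m B *m Bs);
       B *m Bd *m As *m A *m B = As *m A *m B
         /\ Ad *m A *m B *m Bs *m As = B *m Bs *m As].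
Proof.
move=> As Bs; have [uN _] := hN; have [uM _] := hM.
have hAsd : wMP_inverse N M As (wadj N M Ad) by exact: wMP_inverse_wadj.
have AsE : wadj N M As = A by exact: wadjK.
(* The projection onto R(A#) formed from the inverse of A# is A^+ A itself. *)
have QE : As *m wadj N M Ad = Ad *m A.
  by rewrite -(wadjM _ _ _ _ uM); case: hAd.
have gS := projected_gram_wMP hN hM hAsd; rewrite AsE QE in gS.
have gT := projected_gram_wMP hN hL hBd; rewrite -/Bs in gT.
set S := As *m A in gS *; set T := B *m Bs in gT *.
set Q := Ad *m A in QE gS *; set P := B *m Bd in gT *.
have [Ssa Qsa _ _] := gS; have [Tsa Psa _ _] := gT.
have QQ : Q *m Q = Q by rewrite /Q mulmxA; case: hAd => _ ->.
have PP : P *m P = P by rewrite /P mulmxA; case: hBd => ->.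
have fixP := fix_mulmx_proj_comm uN hBd Ssa; rewrite -/P in fixP.
have fixQ := fix_mulmx_proj_comm uN hAsd Tsa; rewrite QE in fixQ.
have subP := range_sub_fix_mulmx S hBd; rewrite -/P in subP.
have subQ := range_sub_fix_mulmx T hAsd; rewrite QE in subQ.
have rhP := range_hermitian_proj_comm uN Psa Ssa PP.
have rhQ := range_hermitian_proj_comm uN Qsa Tsa QQ.
have rhST := range_hermitianM uN Ssa Tsa.
rewrite -[S *m B *m Bs]mulmxA -/T -[P *m As *m A]mulmxA -/S.
rewrite -[Q *m B *m Bs]mulmxA -/T.
tfae.
- move=> /rhST eqR; split; first exact: eq_range_sub uN hBd eqR.
  have := eq_range_sub uN hAsd (S := T); rewrite AsE; apply; exact: esym.
- by move=> [/subP/fixP/rhP ? /subQ/fixQ/rhQ ?].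
- by move=> [/rhP/fixP ? /rhQ/fixQ ?].
- move=> [/fixP PS /fixQ QT]; apply/rhST/seteqP; split.
    exact: (projected_gram_range_sub uN gS gT).
  exact: (projected_gram_range_sub uN gT gS).
Qed.

Theorem theorem3p5 (R : realType) (m n l : nat)
    (M : 'M[R[i]]_m) (N : 'M[R[i]]_n) (L : 'M[R[i]]_l)
    (A : 'M[R[i]]_(m, n)) (B : 'M[R[i]]_(n, l))
    (Ad : 'M[R[i]]_(n, m)) (Bd : 'M[R[i]]_(l, n))
    (hM : weight M) (hN : weight N) (hL : weight L)
    (hAd : wMP_inverse M N A Ad) (hBd : wMP_inverse N L B Bd) :
  let As := wadj M N A in
  let Bs := wadj N L B in
  [<-> range_hermitian N (As *m A *m B *m Bs);
       mxrange (As *m A *m B) `<=` mxrange B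
         /\ mxrange (B *m Bs *m As) `<=` mxrange As;
       range_hermitian N (B *m Bd *m As *m A)
         /\ range_hermitian N (Ad *m A *m B *m Bs);
       B *m Bd *m As *m A *m B = As *m A *m B
         /\ Ad *m A *m B *m Bs *m As = B *m Bs *m As].
Proof. exact: range_hermitian_gram_product_tfae hM hN hL hAd hBd. Qed.
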